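(* Let $R$ be a commutative ring with unity and let $\Gamma(R)$ be its co-maximal ideal graph. Then there exists a vertex of $\Gamma(R)$ which is adjacent to all other vertices of $\Gamma(R)$ if and only if $R$ is isomorphic to the direct product of a local ring and a field.
   Context: All rings are commutative with unity. ${\rm Max}(R)$ denotes the set of maximal ideals of $R$ and ${\rm J}(R)$ the Jacobson radical of $R$. A ring $R$ is called local if $|{\rm Max}(R)|=1$ (no Noetherian hypothesis is assumed). The co-maximal ideal graph $\Gamma(R)$ is the graph whose vertices are the proper ideals of $R$ which are not contained in ${\rm J}(R)$, and two (distinct) vertices $I_1$ and $I_2$ are adjacent if and only if $I_1+I_2=R$. *)

(* Defs.v *)
From HB Require Import structures.
From mathcomp Require Import all_boot all_order all_algebra.
From mathcomp Require Import boolp classical_sets.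

Set Implicit Arguments.
Unset Strict Implicit.
Unset Printing Implicit Defensive.

Import GRing.Theory.
Local Open Scope ring_scope.
Local Open Scope classical_set_scope.

(* Rings are [comPzRingType]s, so the zero ring is allowed.
   An ideal of R is a submodule of the regular module R^o; the library's
   [idealr_closed] is not suitable because it excludes the unit ideal and
   requires a nonzero ring. *)
Definition is_ideal (R : comPzRingType) (I : set R) : Prop :=
  submod_closed (mem (I : set R^o)).

Definition is_proper_ideal (R : comPzRingType) (I : set R) : Prop :=
  is_ideal I /\ I <> setT.

Definition is_maximal_ideal (R : comPzRingType) (M : set R) : Prop :=
  is_proper_ideal M /\
  forall I : set R, is_proper_ideal I -> M `<=` I -> I = M.

Definition max_ideals (R : comPzRingType) : set (set R) :=
  [set M | is_maximal_ideal M].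
Arguments max_ideals R : clear implicits.

(* In the zero ring the intersection is empty, so J(R) = R. *)
Definition jacobson (R : comPzRingType) : set R :=
  \bigcap_(M in max_ideals R) M.
Arguments jacobson R : clear implicits.

Definition is_local (R : comPzRingType) : Prop :=
  exists M : set R, max_ideals R = [set M].

Definition ideal_sum (R : comPzRingType) (I J : set R) : set R :=
  [set x + y | x in I & y in J].

Definition comax_vertex (R : comPzRingType) (I : set R) : Prop :=
  is_proper_ideal I /\ ~ (I `<=` jacobson R).

Definition comax_adj (R : comPzRingType) (I J : set R) : Prop :=
  [/\ comax_vertex I, comax_vertex J, I <> J & ideal_sum I J = setT].

Definition ring_isomorphic (R S : comPzRingType) : Prop :=
  exists f : {rmorphism R -> S}, bijective f.

(* Main.v *)
(* If a vertex I is joined to all others, then I is a maximal ideal: a maximal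
   ideal above I is again a vertex, and it cannot be comaximal with I.  For x in
   I outside J(R), the principal ideals (x) and (x^2) are vertices inside I, so
   both equal I; hence x lies in (x^2) and I is generated by an idempotent e.
   Then R = Re x R(1-e), where R(1-e) = R/I is a field, and Re is local because
   its proper ideals are ideals of R properly contained in I, which are not
   vertices, hence lie in J(R).  Conversely, the vertices of the graph of L x F
   are L x 0 and the A x F with A proper, so L x 0 is joined to all others. *)
Require Import Defs.
From HB Require Import structures.
From mathcomp Require Import all_boot all_order all_algebra.
From mathcomp Require Import boolp classical_sets.
From mathcomp Require Import ring.

Set Implicit Arguments.
Unset Strict Implicit.
Unset Printing Implicit Defensive.

Import GRing.Theory.
Local Open Scope ring_scope.
Local Open Scope classical_set_scope.

(** * Ideals, maximal ideals, the Jacobson radical and local rings *)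

Section Ideals.
Variable R : comPzRingType.
Implicit Types (I J K M : set R) (x y r : R).

Lemma is_idealP I :
  is_ideal I <-> I 0 /\ (forall r x y, I x -> I y -> I (r * x + y)).
Proof.
split=> [[I0 Ilin]|[I0 Ilin]]; split.
- by move: I0; rewrite inE.
- by move=> r x y Ix Iy; have := Ilin r x y; rewrite !inE; exact.
- by rewrite inE.
- by move=> r x y; rewrite !inE; exact: Ilin.
Qed.

Lemma ideal0 I : is_ideal I -> I 0.
Proof. by move/is_idealP => []. Qed.

Lemma idealD I x y : is_ideal I -> I x -> I y -> I (x + y).
Proof. by move/is_idealP => [_ Ilin] Ix Iy; rewrite -[x]mul1r; exact: Ilin. Qed.

Lemma idealMl I r x : is_ideal I -> I x -> I (r * x).
Proof.
by move/is_idealP => [I0 Ilin] Ix; rewrite -[r * x]addr0; exact: Ilin.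
Qed.

Lemma ideal_eqT I : is_ideal I -> I 1 -> I = setT.
Proof.
move=> idI I1; apply/seteqP; split=> // x _.
by rewrite -[x]mulr1; exact: idealMl.
Qed.

Lemma proper_idealP I : is_proper_ideal I <-> is_ideal I /\ ~ I 1.
Proof.
split=> -[idI nI]; split=> //; first by move/(ideal_eqT idI).
by move=> IT; apply: nI; rewrite IT.
Qed.

Definition principal x : set R := [set r * x | r in setT].

Lemma principal_ideal x : is_ideal (principal x).
Proof.
apply/is_idealP; split=> [|r _ _ [s _ <-] [t _ <-]].
  by exists 0 => //; rewrite mul0r.
by exists (r * s + t) => //; rewrite mulrDl mulrA.
Qed.

Lemma mem_principal x : principal x x.
Proof. by exists 1 => //; rewrite mul1r. Qed.

Lemma principal_sub I x : is_ideal I -> I x -> principal x `<=` I.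
Proof. by move=> idI Ix _ [r _ <-]; exact: idealMl. Qed.

Lemma ideal_sum_ideal I J :
  is_ideal I -> is_ideal J -> is_ideal (ideal_sum I J).
Proof.
move=> idI idJ; apply/is_idealP; split.
  by exists 0; [exact: ideal0 | exists 0; [exact: ideal0 | rewrite addr0]].
move=> r _ _ [x Ix [y Jy <-]] [x' Ix' [y' Jy' <-]].
exists (r * x + x'); first by apply: idealD => //; exact: idealMl.
exists (r * y + y'); first by apply: idealD => //; exact: idealMl.
by rewrite mulrDr addrACA.
Qed.

Lemma ideal_sum_sub I J K :
  is_ideal K -> I `<=` K -> J `<=` K -> ideal_sum I J `<=` K.
Proof.
by move=> idK IK JK _ [x /IK Kx [y /JK Ky <-]]; exact: idealD.
Qed.

(** This is invertibility of [x] modulo [M]: the ideal [M + (x)] contains [x], so it is not [M], and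
    maximality forces it to contain 1. *)
Lemma maximal_comax M x : is_maximal_ideal M -> ~ M x ->
  exists r, M (1 - r * x).
Proof.
move=> [/proper_idealP[idM M1] Mmax] Mx.
have idS := ideal_sum_ideal idM (principal_ideal x).
have MS : M `<=` ideal_sum M (principal x).
  move=> y My; exists y => //; exists 0; rewrite ?addr0 //.
  by exact: ideal0 (principal_ideal x).
have [S1|S1] := pselect (ideal_sum M (principal x) 1).
  have [y My [_ [r _ <-] yr]] := S1.
  by exists r; rewrite -yr addrK.
have SM : ideal_sum M (principal x) = M.
  by apply: Mmax => //; apply/proper_idealP.
case: Mx; rewrite -SM; exists 0; first exact: ideal0.
by exists x; [exact: mem_principal | rewrite add0r].
Qed.

Lemma maximal_sqr M x : is_maximal_ideal M -> M (x * x) -> M x.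
Proof.
move=> Mmax Mxx; apply: contrapT => /(maximal_comax Mmax)[r Mr].
have /proper_idealP[idM M1] := Mmax.1.
apply: M1.
(* Difference of squares: both [1 - r * x] and [x * x] lie in [M], so 1 would too. *)
have -> : 1 = (1 + r * x) * (1 - r * x) + (r * r) * (x * x) by ring.
by apply: idealD => //; exact: idealMl.
Qed.

Lemma maximal_ideal_exists I : is_proper_ideal I ->
  exists2 M, is_maximal_ideal M & I `<=` M.
Proof.
(* Adding I to each set makes the union of the empty chain admissible. *)
move=> pI; pose P := [set A : set R | is_proper_ideal (I `|` A)].
have [|A [PA Amax]] := @Zorn_bigcup R P.
  move=> F FP Ftot; have [-> |/set0P[A0 FA0]] := eqVneq F set0.
    by rewrite /P /= bigcup_set0 setU0.
  apply/proper_idealP; split; last first.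
    move=> [I1|[A FA A1]]; first by have /proper_idealP[_] := pI; apply.
    by have /proper_idealP[_] := FP _ FA; apply; right.
  (* Totality of the chain puts two elements of the union into a single member; [A0] serves when
     both come from [I]. *)
  have common x y : (I `|` \bigcup_(X in F) X) x ->
      (I `|` \bigcup_(X in F) X) y ->
      exists2 A, F A & (I `|` A) x /\ (I `|` A) y.
    move=> [Ix|[A FA Ax]] [Iy|[B FB By]].
    - by exists A0 => //; split; left.
    - by exists B => //; split; [left | right].
    - by exists A => //; split; [right | left].
    - have [AB|BA] := Ftot _ _ FA FB.
        by exists B => //; split; right => //; exact: AB.
      by exists A => //; split; right => //; exact: BA.
  apply/is_idealP; split; first by left; exact: ideal0 pI.1.
  move=> r x y /common xF /xF[A FA [Ax Ay]].
  have [idIA _] := FP _ FA.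
  have [|?] : (I `|` A) (r * x + y) by apply: idealD => //; exact: idealMl.
    by left.
  by right; exists A.
exists (I `|` A); last exact: subsetUl.
split=> // B pB IAB; apply/seteqP; split=> // x Bx.
(* A proper ideal [B] above [I] and [A] is itself admissible for Zorn, since its union with [I] is
   [B]; a point of [B] outside would make it strictly larger than [A]. *)
apply: contrapT => IAx; apply: (Amax B).
  split=> [y Ay|BA]; first by apply: IAB; right.
  by apply: IAx; right; exact: BA.
by rewrite /P /= setUidr // => y Iy; apply: IAB; left.
Qed.

(** Read contrapositively, this keeps the ideal generated by a square outside the radical, hence a
    vertex. *)
Lemma jacobson_sqr x : jacobson R (x * x) -> jacobson R x.
Proof. by move=> Jxx M Mmax; apply: (maximal_sqr Mmax); exact: Jxx. Qed.

Lemma jacobson_ideal : is_ideal (jacobson R).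
Proof.
apply/is_idealP; split=> [M [[idM _] _]|r x y Jx Jy M Mmax].
  exact: ideal0.
have [[idM _] _] := Mmax.
by apply: idealD => //; [apply: idealMl => //; exact: Jx | exact: Jy].
Qed.

(** If a maximal ideal missed [x], it would contain some [1 - r * x], which is a unit. *)
Lemma jacobson_unit x :
  (forall r, exists u, u * (1 - r * x) = 1) -> jacobson R x.
Proof.
move=> xunit M Mmax; apply: contrapT => /(maximal_comax Mmax)[r Mr].
have /proper_idealP[idM M1] := Mmax.1.
by apply: M1; have [u <-] := xunit r; exact: idealMl.
Qed.

Lemma local_of_greatest M : is_proper_ideal M ->
  (forall I, is_proper_ideal I -> I `<=` M) -> is_local R.
Proof.
move=> pM Mgr; exists M; apply/seteqP; split=> [P [pP Pmax]|_ ->] /=.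
  by rewrite (Pmax M) //; exact: Mgr.
by split=> // I pI MI; apply/seteqP; split=> //; exact: Mgr.
Qed.

Lemma local_greatest M : max_ideals R = [set M] ->
  is_maximal_ideal M /\ forall I, is_proper_ideal I -> I `<=` M.
Proof.
move=> RM; have Mmax : max_ideals R M by rewrite RM.
split=> // I /maximal_ideal_exists[N Nmax IN].
by have : max_ideals R N by []; rewrite RM => <-.
Qed.

(** A non-unit generates a proper ideal, and [M] contains every proper ideal. *)
Lemma local_unit M x : max_ideals R = [set M] -> ~ M x ->
  exists u, u * x = 1.
Proof.
move=> /local_greatest[_ Mgr] Mx.
have [[u _ ux]|x1] := pselect (principal x 1); first by exists u.
case: Mx; apply: (Mgr (principal x)); last exact: mem_principal.
by apply/proper_idealP; split=> //; exact: principal_ideal.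
Qed.

End Ideals.

(** * Corner rings of an idempotent and the Peirce decomposition *)

Definition idempotent_of (R : comPzRingType) := {e : R | e * e == e}.

(** As [e] is idempotent, this equation describes the ideal [Re] by a boolean test, with no
    quantifier over multipliers. *)
Definition corner_pred (R : comPzRingType) (e : idempotent_of R) : {pred R} :=
  [pred x | x * val e == x].

Lemma corner_zmod_closed (R : comPzRingType) (e : idempotent_of R) :
  zmod_closed (corner_pred e).
Proof.
split=> [|x y]; first by rewrite inE mul0r.
by rewrite !inE mulrBl => /eqP -> /eqP ->.
Qed.

HB.instance Definition _ (R : comPzRingType) (e : idempotent_of R) :=
  GRing.isZmodClosed.Build R (corner_pred e) (corner_zmod_closed e).

Definition corner (R : comPzRingType) (e : idempotent_of R) :=
  {x : R | x \in corner_pred e}.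

HB.instance Definition _ (R : comPzRingType) (e : idempotent_of R) :=
  SubChoice.on (corner e).
HB.instance Definition _ (R : comPzRingType) (e : idempotent_of R) :=
  [SubChoice_isSubZmodule of corner e by <:].

Section Corner.
Variables (R : comPzRingType) (e : idempotent_of R).

Lemma idempotentP : val e * val e = val e.
Proof. exact: eqP (valP e). Qed.

Lemma corner_proj_subproof x : x * val e \in corner_pred e.
Proof. by rewrite inE -mulrA idempotentP. Qed.

Definition corner_proj x : corner e := Sub (x * val e) (corner_proj_subproof x).

Lemma val_corner_proj x : val (corner_proj x) = x * val e.
Proof. exact: SubK. Qed.

Lemma val_corner0 : val (0 : corner e) = 0.
Proof. exact: raddf0. Qed.

Lemma val_cornerD (a b : corner e) : val (a + b) = val a + val b.
Proof. exact: raddfD. Qed.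

Lemma val_cornerB (a b : corner e) : val (a - b) = val a - val b.
Proof. exact: raddfB. Qed.

Lemma val_cornerP (a : corner e) : val a * val e = val a.
Proof. by have := valP a; rewrite inE => /eqP. Qed.

(** The unit of [Re] is [e], so [Re] is in general not a subring of [R]: only its additive structure
    is inherited, and the ring structure is built here. *)
Definition corner_one := corner_proj 1.
Definition corner_mul (a b : corner e) := corner_proj (val a * val b).

Lemma val_corner_mul a b : val (corner_mul a b) = val a * val b.
Proof. by rewrite val_corner_proj -mulrA val_cornerP. Qed.

Lemma corner_mulA : associative corner_mul.
Proof. by move=> a b c; apply: val_inj; rewrite !val_corner_mul mulrA. Qed.

Lemma corner_mulC : commutative corner_mul.
Proof. by move=> a b; apply: val_inj; rewrite !val_corner_mul mulrC. Qed.

Lemma corner_mul1 : left_id corner_one corner_mul.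
Proof.
move=> a; apply: val_inj.
by rewrite val_corner_mul val_corner_proj mul1r mulrC val_cornerP.
Qed.

Lemma corner_mulDl : left_distributive corner_mul +%R.
Proof.
move=> a b c; apply: val_inj.
by rewrite val_cornerD !val_corner_mul val_cornerD mulrDl.
Qed.

HB.instance Definition _ := GRing.Zmodule_isComPzRing.Build (corner e)
  corner_mulA corner_mulC corner_mul1 corner_mulDl.

Lemma val_cornerM (a b : corner e) : val (a * b) = val a * val b.
Proof. exact: val_corner_mul. Qed.

Lemma val_corner1 : val (1 : corner e) = val e.
Proof. by rewrite val_corner_proj mul1r. Qed.

Lemma corner_proj_zmod : zmod_morphism corner_proj.
Proof.
by move=> x y; apply: val_inj; rewrite val_cornerB !val_corner_proj mulrBl.
Qed.

Lemma corner_proj_monoid : monoid_morphism corner_proj.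
Proof.
split=> [//|x y]; apply: val_inj.
by rewrite val_cornerM !val_corner_proj mulrACA idempotentP.
Qed.

HB.instance Definition _ := GRing.isZmodMorphism.Build R (corner e)
  corner_proj corner_proj_zmod.
HB.instance Definition _ := GRing.isMonoidMorphism.Build R (corner e)
  corner_proj corner_proj_monoid.

(** Multiplying [b] in [Re] by [r] is the same as multiplying it by [r * e], which lies in [Re]; so
    ideals of the corner are already ideals of [R]. *)
Lemma corner_ideal_image (B : set (corner e)) : is_ideal B ->
  is_ideal [set val b | b in B].
Proof.
move=> idB; apply/is_idealP; split.
  by exists 0; [exact: ideal0 | rewrite val_corner0].
move=> r _ _ [b Bb <-] [c Bc <-]; exists (corner_proj r * b + c).
  by apply: idealD => //; exact: idealMl.
rewrite val_cornerD val_cornerM val_corner_proj.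
by rewrite -mulrA (mulrC _ (val b)) val_cornerP.
Qed.

Lemma corner_ideal_preimage (I : set R) : is_ideal I ->
  is_ideal [set a : corner e | I (val a)].
Proof.
move=> idI; apply/is_idealP; split.
  by rewrite /mkset val_corner0; exact: ideal0.
move=> r x y; rewrite /mkset => Ix Iy; rewrite val_cornerD val_cornerM.
by apply: idealD => //; exact: idealMl.
Qed.

Lemma idempotent_compl_subproof : (1 - val e) * (1 - val e) == 1 - val e.
Proof.
by rewrite mulrBl mul1r mulrBr mulr1 idempotentP subrr subr0.
Qed.

Definition idempotent_compl : idempotent_of R :=
  exist _ (1 - val e) idempotent_compl_subproof.

Lemma val_idempotent_compl : val idempotent_compl = 1 - val e.
Proof. by []. Qed.

Lemma idempotent_compl_mul : val e * val idempotent_compl = 0.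
Proof. by rewrite val_idempotent_compl mulrBr mulr1 idempotentP subrr. Qed.

End Corner.

Definition peirce (R : comPzRingType) (e : idempotent_of R) (x : R) :
    (corner e * corner (idempotent_compl e))%type :=
  (corner_proj e x, corner_proj (idempotent_compl e) x).

Lemma peirce_zmod (R : comPzRingType) (e : idempotent_of R) :
  zmod_morphism (peirce e).
Proof. by move=> x y; rewrite /peirce !rmorphB. Qed.

Lemma peirce_monoid (R : comPzRingType) (e : idempotent_of R) :
  monoid_morphism (peirce e).
Proof. by split=> [|x y]; rewrite /peirce ?rmorph1 ?rmorphM. Qed.

HB.instance Definition _ (R : comPzRingType) (e : idempotent_of R) :=
  GRing.isZmodMorphism.Build _ _ (peirce e) (peirce_zmod e).
HB.instance Definition _ (R : comPzRingType) (e : idempotent_of R) :=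
  GRing.isMonoidMorphism.Build _ _ (peirce e) (peirce_monoid e).

(** The inverse is addition: [x = x * e + x * (1 - e)], and the cross terms die because
    [e * (1 - e) = 0]. *)
Lemma peirce_bij (R : comPzRingType) (e : idempotent_of R) :
  bijective (peirce e).
Proof.
exists (fun p => val p.1 + val p.2) => [x|[a b]].
  by rewrite /= mulrBr mulr1 addrC subrK.
have ef := idempotent_compl_mul e.
congr pair; apply: val_inj; rewrite val_corner_proj mulrDl val_cornerP.
  by rewrite -[val b]val_cornerP -mulrA [_ * val e]mulrC ef mulr0 addr0.
by rewrite -[val a]val_cornerP -mulrA ef mulr0 add0r.
Qed.


(** The field structure is laid over [K] with its carrier and operations unchanged, so the given
    isomorphism still has the right type. *)
Lemma ring_isomorphic_field (R L K : comPzRingType) : 1 != 0 :> K ->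
  (forall x : K, x != 0 -> exists y, y * x = 1) ->
  ring_isomorphic R (L * K)%type ->
  exists F : fieldType, ring_isomorphic R (L * F)%type.
Proof.
move=> K1 Kinv iso.
(* The default 0 is taken exactly when no inverse exists, which gives the convention [inv 0 = 0] of
   field structures. *)
pose inv (x : K) : K := xget 0 [set y | y * x = 1].
have mulVx (x : K) : x != 0 -> inv x * x = 1.
  move=> /Kinv[y yx]; rewrite /inv.
  by case: xgetP => [z _ //|/(_ y)]; case.
have inv0 : inv 0 = 0.
  rewrite /inv; case: xgetP => // y _ /= /eqP.
  by rewrite mulr0 eq_sym (negPf K1).
pose nzm := GRing.PzSemiRing_isNonZero.Build K K1.
pose NZ : comNzRingType := HB.pack (GRing.ComPzRing.sort K) nzm.
pose fm := GRing.ComNzRing_isField.Build NZ mulVx inv0.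
pose F : fieldType := HB.pack (GRing.ComNzRing.sort NZ) fm.
by exists F; exact: iso.
Qed.

(** * Consequences of a vertex adjacent to all others *)

Lemma universal_vertex_maximal (R : comPzRingType) (I : set R) :
  comax_vertex I ->
  (forall J : set R, comax_vertex J -> J <> I -> comax_adj I J) ->
  is_maximal_ideal I.
Proof.
move=> [pI IJ] adjI; have [M Mmax IM] := maximal_ideal_exists pI.
have [<- //|MI] := pselect (M = I).
have vM : comax_vertex M.
  by split; [exact: Mmax.1 | move=> MJ; apply: IJ => x /IM /MJ].
have [_ _ _ IMT] := adjI _ vM MI.
have /proper_idealP[idM []] := Mmax.1.
have : ideal_sum I M 1 by rewrite IMT.
exact: ideal_sum_sub.
Qed.

(** Otherwise [J] would be another vertex, forcing [I + J = R], although [I + J] stays inside the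
    proper ideal [I]. *)
Lemma universal_vertex_sub (R : comPzRingType) (I J : set R) :
  comax_vertex I ->
  (forall J : set R, comax_vertex J -> J <> I -> comax_adj I J) ->
  is_ideal J -> J `<=` I -> ~ (J `<=` jacobson R) -> J = I.
Proof.
move=> [/proper_idealP[idI I1] IJ] adjI idJ JI JJ.
apply: contrapT => nJI.
have vJ : comax_vertex J by split=> //; apply/proper_idealP; split=> // /JI.
have [_ _ _ IJT] := adjI _ vJ nJI.
have : ideal_sum I J 1 by rewrite IJT.
by move/(ideal_sum_sub idI (@subset_refl _ I) JI).
Qed.

Lemma universal_vertex_idempotent (R : comPzRingType) (I : set R) :
  comax_vertex I ->
  (forall J : set R, comax_vertex J -> J <> I -> comax_adj I J) ->
  exists e : idempotent_of R, I = principal (val e).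
Proof.
move=> vI adjI; have [/proper_idealP[idI I1] IJ] := vI.
have [x Ix Jx] : exists2 x, I x & ~ jacobson R x.
  apply: contrapT => nx; apply: IJ => x Ix.
  by apply: contrapT => Jx; apply: nx; exists x.
have xxI : principal (x * x) = I.
  apply: universal_vertex_sub adjI _ _ _ => //.
  - exact: principal_ideal.
  - by apply: principal_sub => //; exact: idealMl.
  - by move=> /(_ _ (mem_principal (x * x))) /jacobson_sqr.
have [r _ rxx] : principal (x * x) x by rewrite xxI.
(* From [r * (x * x) = x] it follows that [r * x] is idempotent and that multiplying [x * x] by it
   changes nothing, so it generates [I]. *)
have ee : (r * x) * (r * x) == r * x.
  have -> : r * x * (r * x) = r * (r * (x * x)) by ring.
  by rewrite rxx.
exists (exist _ (r * x) ee); rewrite /=; apply/seteqP; split; last first.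
  by apply: principal_sub => //; exact: idealMl.
rewrite -xxI; apply: principal_sub; first exact: principal_ideal.
by exists (x * x) => //; rewrite -[RHS](congr1 ( *%R x) rxx) /=; ring.
Qed.

(** * The two corners: a local ring and a field *)

Section Decomposition.
Variables (R : comPzRingType) (e : idempotent_of R).
Hypothesis ve : comax_vertex (principal (val e)).
Hypothesis adje : forall J : set R,
  comax_vertex J -> J <> principal (val e) -> comax_adj (principal (val e)) J.

(** The greatest proper ideal is the trace of J(R) on [Re]. An ideal of [Re] not inside it must be
    all of [(e)], hence contains the unit [e]. *)
Lemma corner_local : is_local (corner e).
Proof.
have [pe eJ] := ve.
have Je : ~ jacobson R (val e).
  by move=> /(principal_sub (jacobson_ideal R)).
apply: (@local_of_greatest _ [set a : corner e | jacobson R (val a)]).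
  apply/proper_idealP; split.
    exact: corner_ideal_preimage (jacobson_ideal R).
  by rewrite /mkset val_corner1.
move=> B /proper_idealP[idB B1] b Bb; apply: contrapT => /= Jb.
have BI : [set val c | c in B] = principal (val e).
  apply: universal_vertex_sub adje _ _ _ => //.
  - exact: corner_ideal_image.
  - by move=> _ [c _ <-]; exists (val c) => //; exact: val_cornerP.
  - by move=> BJ; apply: Jb; apply: BJ; exists b.
have [c Bc ce] : [set val c | c in B] (val e).
  by rewrite BI; exact: mem_principal.
by apply: B1; rewrite -(_ : c = 1) //; apply: val_inj; rewrite val_corner1.
Qed.

Let f := idempotent_compl e.

Lemma corner_compl_neq0 : 1 != 0 :> corner f.
Proof.
have [/proper_idealP[_ e1] _] := ve.
apply/eqP => /(congr1 val).
rewrite val_corner1 val_corner0 val_idempotent_compl => /subr0_eq ef.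
by apply: e1; rewrite [X in principal _ X]ef; exact: mem_principal.
Qed.

(** The ideal [(e)] is maximal and meets [Rf] only in 0, so [1 - r * y] lies in [(e)] for some [r];
    multiplying by [f] kills it and leaves [r * f] as the inverse. *)
Lemma corner_compl_inv (y : corner f) : y != 0 -> exists z, z * y = 1.
Proof.
move=> y0; have fe : val e * val f = 0 := idempotent_compl_mul e.
have Imax := universal_vertex_maximal ve adje.
have [|r [s _ sry]] := maximal_comax (x := val y) Imax.
  move=> [s _ sy]; move/eqP: y0; apply; apply: val_inj.
  by rewrite val_corner0 -val_cornerP -sy -mulrA fe mulr0.
exists (corner_proj f r); apply: val_inj.
rewrite val_cornerM val_corner1 val_corner_proj mulrAC -mulrA val_cornerP.
have /eqP : (1 - r * val y) * val f = 0 by rewrite -sry -mulrA fe mulr0.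
by rewrite mulrBl mul1r -mulrA val_cornerP subr_eq0 => /eqP.
Qed.

End Decomposition.

(** * The product of a local ring and a field *)

Section Converse.
Variables (R L : comPzRingType) (F : fieldType).
Variables (f : {rmorphism R -> (L * F)%type}) (g : L * F -> R).
Hypotheses (fK : cancel f g) (gK : cancel g f).
Variable M : set L.
Hypothesis LM : max_ideals L = [set M].

(** The inverse [g] is a bare function, so identities involving it are checked after applying [f],
    component by component. *)
Lemma inv_rmorph_inj x y : f x = f y -> x = y.
Proof. exact: can_inj fK x y. Qed.

Lemma fst_preimage_ideal (A : set L) : is_ideal A ->
  is_ideal [set x | A (f x).1].
Proof.
move=> idA; apply/is_idealP; split; first by rewrite /= rmorph0; exact: ideal0.
move=> r x y /= Ax Ay; rewrite rmorphD rmorphM /=.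
by apply: idealD => //; exact: idealMl.
Qed.

Let I : set R := [set x | (f x).2 = 0].

Lemma snd_kernel_ideal : is_ideal I.
Proof.
apply/is_idealP; split=> [|r x y]; rewrite /I /= ?rmorph0 //.
by move=> x0 y0; rewrite rmorphD rmorphM /= x0 y0 mulr0 addr0.
Qed.

(** This is [M x F] in the product. A proper ideal [K] above it contains [(0, 1)], so it cannot
    contain [(1, 0)]; its trace [A] on [L x 0] is therefore proper and lies in [M]. *)
Lemma fst_preimage_maximal : is_maximal_ideal [set x | M (f x).1].
Proof.
have [[pM Mmax] Mgr] := local_greatest LM.
have /proper_idealP[idM M1] := pM.
split.
  apply/proper_idealP; split; first exact: fst_preimage_ideal.
  by rewrite /= rmorph1.
move=> K /proper_idealP[idK K1] NK; apply/seteqP; split=> // x Kx.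
pose A : set L := [set a | K (g (a, 0))].
apply: (Mgr A); last first.
  have -> : A (f x).1 = K (g (1, 0) * x).
    rewrite /A /=; congr K; apply: inv_rmorph_inj; rewrite rmorphM !gK.
    by congr pair; rewrite /= ?mul1r ?mul0r.
  exact: idealMl.
apply/proper_idealP; split.
  apply/is_idealP; split.
    rewrite /A /= (_ : g _ = 0); first exact: ideal0.
    by apply: inv_rmorph_inj; rewrite gK rmorph0.
  move=> r a b /= Ka Kb; rewrite /A /=.
  rewrite (_ : g _ = g (r, 0) * g (a, 0) + g (b, 0)).
    by apply: idealD => //; exact: idealMl.
  apply: inv_rmorph_inj; rewrite rmorphD rmorphM !gK.
  by congr pair; rewrite /= mul0r addr0.
move=> A1; apply: K1; rewrite (_ : 1 = g (1, 0) + g (0, 1)).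
  apply: idealD => //; apply: NK; rewrite /= gK /=; exact: ideal0.
apply: inv_rmorph_inj; rewrite rmorphD rmorph1 !gK.
by congr pair; rewrite /= ?addr0 ?add0r.
Qed.

(** The element [(1, 0)] belongs to [L x 0] but not to the maximal ideal [M x F], so it is outside
    the radical. *)
Lemma snd_kernel_vertex : comax_vertex I.
Proof.
have [[pM _] _] := local_greatest LM; have /proper_idealP[idM M1] := pM.
split.
  apply/proper_idealP; split; first exact: snd_kernel_ideal.
  by rewrite /I /= rmorph1 /=; apply/eqP; exact: oner_neq0.
move=> /(_ (g (1, 0))); rewrite /I /= gK.
move=> /(_ erefl) /(_ _ fst_preimage_maximal).
by rewrite /= gK.
Qed.

Lemma snd_kernel_universal (J : set R) :
  comax_vertex J -> J <> I -> comax_adj I J.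
Proof.
move=> vJ JI; have [/proper_idealP[idJ J1] JJ] := vJ.
split=> //; [exact: snd_kernel_vertex | by move=> IJ; apply: JI | ].
apply: ideal_eqT; first exact: ideal_sum_ideal snd_kernel_ideal idJ.
have [JsI|] := pselect (J `<=` I); last first.
  move=> /existsNP[x /not_implyP[Jx /eqP x0]].
  (* For [x = (a, b)] in [J] with [b] nonzero, [(1 - a, 0) + (1, b^-1) * (a, b) = (1, 1)]. *)
  exists (g (1 - ((f x).1), 0)); first by rewrite /I /= gK.
  exists (g (1, (f x).2^-1) * x); first exact: idealMl.
  apply: inv_rmorph_inj; rewrite rmorphD rmorphM rmorph1 !gK.
  by congr pair; rewrite /= ?mul1r ?subrK // mulVf // add0r.
(* In the remaining case [J] lies in [L x 0]; it is shown to lie in J(R), against its being a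
   vertex. *)
case: JJ => x Jx; have x2 : (f x).2 = 0 := JsI _ Jx.
(* If (f x).1 were a unit, J would contain L x 0 and so be equal to I. *)
have Mx : M (f x).1.
  apply: contrapT => /(local_unit LM)[u ux]; apply: JI.
  apply/seteqP; split=> // y y2.
  rewrite (_ : y = (y * g (u, 0)) * x); first exact: idealMl.
  apply: inv_rmorph_inj; rewrite !rmorphM gK [LHS]surjective_pairing.
  by congr pair; rewrite /= ?x2 ?mulr0 // -mulrA ux mulr1.
have [[pM _] _] := local_greatest LM; have /proper_idealP[idM M1] := pM.
(* Since [x] has second component 0, [1 - r * x] has second component 1, and its first component is
   a unit of [L] because it lies outside [M]. *)
apply: jacobson_unit => r.
have [|u ux] := @local_unit _ _ (1 - (f r).1 * (f x).1) LM.
  move=> Mrx; apply: M1; rewrite -(subrK ((f r).1 * (f x).1) 1).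
  by apply: idealD => //; exact: idealMl.
exists (g (u, 1)); apply: inv_rmorph_inj.
rewrite rmorphM rmorphB rmorphM rmorph1 gK.
by congr pair; rewrite /= ?x2 // mulr0 subr0 mulr1.
Qed.

End Converse.

Theorem theorem1 (R : comPzRingType) :
  (exists I : set R,
     comax_vertex I /\
     forall J : set R, comax_vertex J -> J <> I -> comax_adj I J)
  <->
  (exists (L : comPzRingType) (F : fieldType),
     is_local L /\ ring_isomorphic R (L * F)%type).
Proof.
split=> [[I [vI adjI]]|[L [F [[M LM] [f [g fK gK]]]]]]; last first.
  exists [set x | (f x).2 = 0]; split.
    exact: (@snd_kernel_vertex R L F f g fK gK M LM).
  exact: (@snd_kernel_universal R L F f g fK gK M LM).
have [e eI] := universal_vertex_idempotent vI adjI.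
rewrite eI in vI adjI.
have [F RF] : exists F : fieldType, ring_isomorphic R (corner e * F)%type.
  apply: (ring_isomorphic_field (corner_compl_neq0 vI)).
    exact: corner_compl_inv vI adjI.
  by exists (peirce e : {rmorphism _ -> _}); exact: peirce_bij.
by exists (corner e), F; split=> //; exact: corner_local.
Qed.
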